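(* There is an absolute constant $C>0$ such that for every $n\ge1$ and every soluble transitive subgroup $G\le S_n$, \[ \operatorname{diam}(G)\le C\,n^5 . \]
   Context: For a group $G$ and $X\subseteq G$, $\ell_X(g)$ is the minimal length of an expression of $g$ as a product of elements of $X\cup X^{-1}$ ($\infty$ if none exists). For a finite group $G$ with generating set $X$, $\operatorname{diam}(G,X)=\max_{g\in G}\ell_X(g)$, and $\operatorname{diam}(G)=\max\{\operatorname{diam}(G,X): X \text{ a generating set for } G\}$. *)

(* Defs.v *)
From mathcomp Require Import all_boot all_fingroup all_solvable.

Set Implicit Arguments.
Unset Strict Implicit.
Unset Printing Implicit Defensive.

Import GroupScope.

Section Diameter.
Variable gT : finGroupType.
Implicit Types (X : {set gT}) (g : gT) (G : {group gT}).

(* [A ^+ k] is the set of products of exactly k elements of A (with A ^+ 0 the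
   singleton of the identity), so [wordn X g k] says that g is a product of
   k elements of X and inverses of elements of X. *)
Definition wordn X g (k : nat) : bool := g \in (X :|: X^-1) ^+ k.

Lemma wordP X g : reflect (exists k, wordn X g k) (g \in <<X>>).
Proof.
apply: (iffP idP) => [|[k]].
  case/gen_prodgP => k [c cX ->]; exists k; rewrite /wordn.
  elim: k c cX => [|k IHk] c cX; first by rewrite big_ord0 expg0 set11.
  by rewrite big_ord_recl expgS mem_mulg ?IHk // inE cX.
rewrite /wordn; elim: k g => [|k IHk] g; first by rewrite expg0 => /set1gP->.
rewrite expgS => /mulsgP[x y /setUP[Xx|Xx] /IHk Xy ->]; rewrite groupM //.
  exact: mem_gen.
by rewrite -groupV mem_gen // -mem_invg.
Qed.

(* [None] stands for an infinite length. *)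
Definition wlength X g : option nat :=
  match decP (wordP X g) with
  | left ex_k => Some (ex_minn ex_k)
  | right _ => None
  end.

Variant wlength_spec X g : option nat -> Prop :=
  | WlengthSome k of wordn X g k & (forall j, wordn X g j -> (k <= j)%N) :
      wlength_spec X g (Some k)
  | WlengthNone of (forall k, ~~ wordn X g k) : wlength_spec X g None.

Lemma wlengthP X g : wlength_spec X g (wlength X g).
Proof.
rewrite /wlength; case: (decP _) => [ex_k | no_k].
  by case: ex_minnP => k Xk min_k; constructor.
by constructor=> k; apply/negP=> Xk; case: no_k; exists k.
Qed.

Lemma wlength_gen X g : (wlength X g != None) = (g \in <<X>>).
Proof.
case: wlengthP => [k Xk _ | no_k]; apply/esym; first by apply/wordP; exists k.
by apply/negP=> /wordP[k]; apply/negP.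
Qed.

(* Used only when <<X>> = G: by [wlength_gen] the default value 0 is then never
   taken. *)
Definition diam_wrt G X : nat := \max_(g in G) odflt 0%N (wlength X g).

Definition diam G : nat := \max_(X : {set gT} | <<X>> == G) diam_wrt G X.

End Diameter.

(* Main.v *)
(** Let S be a point stabiliser in G, of index n and trivial core. Since G is
soluble, the sum of the prime factors of |G|, counted with multiplicity, is
O(n): refining G to a chain of stabilisers of minimal blocks, every step is an
affine primitive group over a space of order m, whose order divides
m |GL(k, p)| with m = p^k.

For a proper normal subgroup M of G, a short word y outside M whose normal
closure is elementary abelian modulo M lets one pass from M to M<y^G>: a basis
of the section consists of conjugates of y by words of length O(n), and each
basis vector costs p - 1 copies of y. So diam(G) is O(n) times the largest
length of such a y, up to a term O(n^2), and it is enough to find y of length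
O(n^4).

Such words come from a descent on stabilisers. Let T be minimal over S, with
affine action of degree m = p^k and translation group V. Replacing S by the
stabiliser S1 in T of a vector of V changes the core only by an elementary
abelian p-section, because core(S1) fixes the T-orbit of the vector, hence
centralises V. A good y for S1 then gives one for S: y itself, or [y, y^w], or
y^q. This multiplies the length by max(4, p) at most, up to O(n), while the
index drops. Following the chain S, S1, N, T, where N is the stabiliser of the
line of the vector, the total loss from S to T is at most m^4 / 4; the factor
1/4 is what allows the induction to pass through imprimitive actions. When the vectors form a single
orbit of prime-power size 2^k - 1 on which T is primitive, the size has to be
prime, and this case is settled by a direct estimate. *)

Require Import Defs.
From mathcomp Require Import all_boot all_fingroup all_solvable.
From mathcomp Require Import all_algebra all_character zify ring.

Set Implicit Arguments.
Unset Strict Implicit.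
Unset Printing Implicit Defensive.

(** * Arithmetic *)

(* Sum of the prime factors with multiplicity; it bounds the length of subgroup
   chains as well as the cost of expanding an elementary abelian section. *)
Definition sopfr n := \sum_(p < n.+1 | prime p) p * logn p n.

Lemma sopfr_widen N n : n <= N -> sopfr n = \sum_(p < N.+1 | prime p) p * logn p n.
Proof.
case: n => [|n] lenN; first by rewrite /sopfr !big1 // => i _; rewrite logn0 muln0.
rewrite /sopfr (big_ord_widen_cond N.+1 (fun p => prime p) (fun p => p * logn p n.+1)) ?ltnS //.
rewrite [RHS](bigID (fun i : 'I_N.+1 => i < n.+2)) /= [X in _ = _ + X]big1 ?addn0 //.
move=> i /andP[_]; rewrite -leqNgt => ltni.
rewrite lognE; case: ifP; rewrite ?muln0 //.
by case/and3P=> _ _ /(dvdn_leq (ltn0Sn n)); rewrite leqNgt ltni.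
Qed.

Lemma sopfrM m n : 0 < m -> 0 < n -> sopfr (m * n) = sopfr m + sopfr n.
Proof.
move=> m0 n0; rewrite (@sopfr_widen (m * n) m) ?leq_pmulr //.
rewrite (@sopfr_widen (m * n) n) ?leq_pmull // -big_split /=.
by apply: eq_bigr => p _; rewrite lognM // mulnDr.
Qed.

Lemma sopfr1 : sopfr 1 = 0.
Proof. by rewrite /sopfr big1 // => i _; rewrite logn1 muln0. Qed.

Lemma sopfr_prime p : prime p -> sopfr p = p.
Proof.
move=> pp; rewrite /sopfr (bigD1 (inord p)) /= ?inordK //.
rewrite logn_prime // eqxx muln1 big1 ?addn0 // => i /andP[pi].
rewrite -val_eqE /= inordK // => ne; rewrite logn_prime // eq_sym.
by rewrite eq_sym (negPf ne) muln0.
Qed.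

Lemma sopfrX m k : 0 < m -> sopfr (m ^ k) = k * sopfr m.
Proof.
move=> m0; elim: k => [|k IHk]; first by rewrite expn0 sopfr1.
by rewrite expnS sopfrM ?expn_gt0 ?m0 // IHk mulSn.
Qed.

Lemma sopfr_leq n : 0 < n -> sopfr n <= n.
Proof.
elim/ltn_ind: n => n IHn n0; have [n1|n1] := leqP n 1.
  by rewrite (_ : n = 1) ?sopfr1 //; lia.
have := pdiv_prime n1; set p := pdiv n => pp.
have /dvdnP[q def_n] : p %| n := pdiv_dvd n.
have p1 := prime_gt1 pp.
have q0 : 0 < q by case: q def_n => // def_n; rewrite def_n in n0.
have ltqn : q < n by rewrite def_n; nia.
rewrite def_n sopfrM ?(ltnW p1) // (sopfr_prime pp).
have [q1|q1] := leqP q 1.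
  have -> : q = 1 by lia.
  by rewrite sopfr1 mul1n.
have := IHn q ltqn q0; nia.
Qed.

Lemma sopfr_dvd m n : 0 < n -> m %| n -> sopfr m <= sopfr n.
Proof.
move=> n0 /dvdnP[q def_n]; rewrite def_n sopfrM ?leq_addl //.
  by case: q def_n => // e; rewrite e in n0.
by case: m def_n => // e; rewrite e muln0 in n0.
Qed.

Lemma sopfr_gt0 n : 1 < n -> 0 < sopfr n.
Proof.
move=> n1; apply: leq_trans (sopfr_dvd (ltnW n1) (pdiv_dvd n)).
by rewrite sopfr_prime ?pdiv_prime ?prime_gt0 ?pdiv_prime.
Qed.

(* The alternating sum of the powers of q below an odd exponent is odd. *)
Lemma odd_cofactor q i : odd q -> exists2 s, odd s & q ^ (i.*2.+1) + 1 = (q + 1) * s.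
Proof.
move=> oq; elim: i => [|i [s os IHi]]; first by exists 1; rewrite // muln1 expn1.
exists (q ^ 2 * s - q.-1).
  rewrite oddB ?oddM ?oddX ?os ?oq /=; last by nia.
  by rewrite -subn1 oddB ?oq //; case: q oq {IHi}.
have -> : q ^ (i.+1).*2.+1 = q ^ 2 * q ^ i.*2.+1 by rewrite -expnD; congr (_ ^ _); lia.
by case: q oq IHi => // q _ IHi /=; nia.
Qed.

(** Here q is odd. An even l would make q^l + 1 congruent to 2 modulo 4, against k > 1; for odd l
    the odd cofactor of q + 1 divides 2^k, so it is 1. *)
Lemma mersenne_prime_power q l k : 1 < k -> 0 < l -> (q ^ l).+1 = 2 ^ k -> l = 1.
Proof.
move=> k1 l0 eql.
have oq : odd q.
  have : odd (q ^ l).+1 = false by rewrite eql oddX; case: k k1 {eql}.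
  by rewrite /= oddX; case: l l0 {eql} => //= l _ /negbFE.
have ol : odd l.
  apply/negPn/negP=> el; have def_l : l = l./2.*2 by rewrite -[LHS]odd_double_half (negPf el).
  have [r def_r] : exists r, q ^ l./2 = r.*2.+1.
    by exists (q ^ l./2)./2; rewrite -[LHS]odd_double_half oddX oq orbT.
  have sq : q ^ l = (r.*2.+1) ^ 2 by rewrite def_l -mul2n mulnC expnM def_r.
  have [k' def_k] : exists k', k = k'.+2 by case: k k1 {eql} => [|[|k']] // _; exists k'.
  by move: eql; rewrite sq def_k !expnS; nia.
have def_l : l = (l./2).*2.+1 by rewrite -[LHS]odd_double_half ol.
have [s os def_s] := odd_cofactor l./2 oq.
rewrite -def_l addn1 eql in def_s.
have /dvdn_pfactor[//|b _ def_b] : s %| 2 ^ k by rewrite def_s dvdn_mull.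
have b0 : b = 0 by move: os; rewrite def_b oddX; case: b {def_b} => //= b; rewrite orbF.
have q1 : 1 < q.
  case: q oq eql {def_s} => [|[|q]] //; rewrite exp1n => _.
  by case: k k1 => [|[|k]] // _; rewrite !expnS; lia.
move: def_s; rewrite def_b b0 muln1 -eql addn1 => -[e].
by apply: (expnI q1); rewrite e expn1.
Qed.

(* Passing from y to [y, y^w] costs a factor 4, passing to y^p a factor p. *)
Definition step_cost p := maxn 4 p.

Lemma step_costP p : 1 < p ->
  [\/ p = 2 /\ step_cost p = 4, p = 3 /\ step_cost p = 4 | 3 < p /\ step_cost p = p].
Proof.
move=> p1; have [p4|p4] := ltnP 3 p; last first.
  by case: p p1 p4 => [|[|[|[|p]]]] // _ _; [constructor 1 | constructor 2].
by constructor 3; split=> //; apply/maxn_idPr.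
Qed.

(** In this and the similar inequalities, m, u and j stand for |T : S|, |T : N| and |N : S1| in an
    affine chain of characteristic p. *)
Lemma four_cost_sq_leq m p j :
  1 < p -> p <= m -> 0 < j -> j <= p.-1 -> 4 * step_cost p * j ^ 2 <= m ^ 4.
Proof.
move=> p1 pm j0 jp; apply: (@leq_trans (p ^ 4)); last by rewrite leq_exp2r.
have [[ep es]|[ep es]|[p3 es]] := step_costP p1; rewrite es.
- by move: jp; rewrite ep /=; case: j j0 => [|[|j]].
- by move: jp; rewrite ep /=; case: j j0 => [|[|[|j]]].
apply: (@leq_trans (p * p * p ^ 2)); last by rewrite mulnn -expnD.
have jp' : j <= p by lia.
by rewrite leq_mul ?leq_exp2r // leq_mul.
Qed.

Lemma two_cost_leq m p j : 1 < p -> p <= m -> 0 < j -> j <= p.-1 -> 2 * step_cost p * j <= m ^ 3.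
Proof.
move=> p1 pm j0 jp; apply: (@leq_trans (p ^ 3)); last by rewrite leq_exp2r.
have [[ep es]|[ep es]|[p3 es]] := step_costP p1; rewrite es.
- by move: jp; rewrite ep /=; case: j j0 => [|[|j]].
- by move: jp; rewrite ep /=; case: j j0 => [|[|[|j]]].
by rewrite !expnS expn0 muln1 -mulnA; nia.
Qed.

Lemma cost_sq_exp4_leq m p j u : 2 < p -> 0 < j -> j <= p.-1 -> u * p.-1 <= m ->
  step_cost p * j ^ 2 * u ^ 4 <= m ^ 4.
Proof.
move=> p2 j0 jp um; apply: (@leq_trans ((u * p.-1) ^ 4)); last by rewrite leq_exp2r.
rewrite expnMn mulnC leq_mul2l; apply/orP; right.
have sp : step_cost p <= p.-1 ^ 2.
  have [[ep es]|[ep es]|[p3 es]] := step_costP (ltnW p2); rewrite es; [lia | by rewrite ep |].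
  by rewrite -mulnn; nia.
by rewrite (expnD _ 2 2) leq_mul // leq_exp2r.
Qed.

Lemma cost_exp3_leq m p j u : 2 < p -> 0 < j -> j <= p.-1 -> u * p.-1 <= m ->
  step_cost p * j * u ^ 3 <= 2 * m ^ 3.
Proof.
move=> p2 j0 jp um; apply: (@leq_trans (2 * (u * p.-1) ^ 3)); last by rewrite leq_mul2l leq_exp2r.
rewrite expnMn mulnC (mulnCA 2) leq_mul2l; apply/orP; right.
have sp : step_cost p <= p.-1 ^ 2.
  have [[ep es]|[ep es]|[p3 es]] := step_costP (ltnW p2); rewrite es; [lia | by rewrite ep |].
  by rewrite -mulnn; nia.
apply: leq_trans (leq_mul sp jp) _; rewrite -expnSr; apply: leq_pmull; lia.
Qed.

(** Used when q is a Mersenne prime and |T : S| = q + 1. It is nearly sharp: q = 7 and j = 6 give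
    4032 against 4096. *)
Lemma cost_sq_leq_succ q j : 2 < q -> 0 < j -> j <= q.-1 -> 16 * step_cost q * j ^ 2 <= q.+1 ^ 4.
Proof.
move=> q2 j0 jq; apply: (@leq_trans (16 * step_cost q * q.-1 ^ 2)).
  by rewrite leq_mul2l leq_exp2r ?jq ?orbT.
have [[ep es]|[ep es]|[p3 es]] := step_costP (ltnW q2); rewrite es; [lia | by rewrite ep |].
(* With x = q + 1, the difference x^4 - 16 (x - 1) (x - 2)^2 is the square of x^2 - 8 x + 8; writing
   q = s + 7 avoids subtraction. *)
case: q p3 {q2 jq es} => [|[|[|[|[|[|[|s]]]]]]] //= _.
have -> : s.+4.+4 ^ 4 = 16 * s.+4.+3 * s.+4.+2 ^ 2 + (s ^ 2 + 8 * s + 8) ^ 2 by ring.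
exact: leq_addr.
Qed.

Lemma cost_mul_leq_succ q j : 2 < q -> 0 < j -> j <= q.-1 -> 8 * step_cost q * j * q <= q.+1 ^ 4.
Proof.
move=> q2 j0 jq; apply: (@leq_trans (8 * step_cost q * q.-1 * q)).
  by rewrite leq_mul2r leq_mul2l jq !orbT.
have [[ep es]|[ep es]|[p3 es]] := step_costP (ltnW q2); rewrite es; [lia | by rewrite ep |].
case: q p3 {q2 jq es} => [|[|[|[|s]]]] //= _.
have -> : s.+4.+1 ^ 4 = 8 * s.+4 * s.+3 * s.+4 + (s.+4 ^ 3 * s + 14 * s.+4 ^ 2 + 4 * s.+4 + 1) by ring.
exact: leq_addr.
Qed.

Lemma leq_index_arith k m a b : 0 < k -> 1 < m ->
  a <= 4 * (k - 1) -> b <= k * (4 * (m - 1)) -> a + b <= 4 * (k * m - 1).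
Proof.
case: m => // m k0 _; rewrite subSS subn0 mulnCA mulnS => lea.
by move: (k * m)%N => km; lia.
Qed.

(** Here n = |G : S|, n1 = |G : S1| and s is a step cost. The loss 4 rho is at most 16 n, and 64 n
    is at most 16 s n; the resulting 32 s n fits into 64 s n1. This is where the constant 64 comes
    from. *)
Lemma step_lt_arith s a b c n n1 rho : 4 <= s -> rho <= 4 * n -> n <= 2 * n1 ->
  b * (c + 64 * n1) <= a -> b * (s * (c + 4 * rho) + 64 * n) <= s * a.
Proof.
move=> s4 lerho len lea; apply: (@leq_trans (s * (b * (c + 64 * n1)))); last first.
  by rewrite leq_mul2l lea orbT.
rewrite mulnCA leq_mul2l; apply/orP; right.
have : 16 * n * 4 <= 16 * n * s by rewrite leq_mul2l s4 orbT.
have : s * rho <= s * (4 * n) by rewrite leq_mul2l lerho orbT.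
have : s * n <= s * (2 * n1) by rewrite leq_mul2l len orbT.
clear lea lerho len; lia.
Qed.

(** If t = |T : S1| is at most half of m = |T : S|, the term 64 |G : S1| may be too small to absorb
    the loss; enlarging the bound by m / (2 t) restores the balance. *)
Lemma step_gt_arith s a b c n' m t rho : 4 <= s -> rho <= 4 * (n' * m) -> 2 * t <= m ->
  b * (c + 64 * (n' * t)) <= a ->
  2 * b * t * (s * (c + 4 * rho) + 64 * (n' * m)) <= s * a * m.
Proof.
move=> s4 lerho ltm lea; apply: (@leq_trans (s * (b * (c + 64 * (n' * t))) * m)); last first.
  by rewrite leq_mul2r leq_mul2l lea !orbT.
have -> : 2 * b * t * (s * (c + 4 * rho) + 64 * (n' * m)) =
    b * (2 * t * (s * (c + 4 * rho) + 64 * (n' * m))) by ring.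
have -> : s * (b * (c + 64 * (n' * t))) * m = b * (s * m * c + 64 * s * (n' * t) * m) by ring.
rewrite leq_mul2l; apply/orP; right.
apply: (@leq_trans (2 * t * (s * c) + 2 * t * (s * (4 * (4 * (n' * m)))  + 16 * s * (n' * m)))).
  have le64 : 64 <= 16 * s by lia.
  rewrite -mulnDr addnA -mulnDr leq_mul2l; apply/orP; right.
  by apply: leq_add; rewrite ?leq_mul // leq_add2l leq_mul.
apply: leq_add; last by apply: eq_leq; ring.
have -> : 2 * t * (s * c) = s * (2 * t) * c by ring.
by rewrite leq_mul ?leq_mul.
Qed.

Lemma step_cost_leq2 p : 1 < p -> step_cost p <= 2 * p.
Proof. by rewrite /step_cost; lia. Qed.

Lemma abelian_arith u q s a b :
  s <= 2 * q -> s * (u ^ 2 * a) * q * b <= (u * q) ^ 2 * a * (2 * b * 1).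
Proof.
move=> sq; have -> : s * (u ^ 2 * a) * q * b = s * (u ^ 2 * a * q * b) by ring.
have -> : (u * q) ^ 2 * a * (2 * b * 1) = 2 * q * (u ^ 2 * a * q * b) by ring.
by rewrite leq_mul2r sq orbT.
Qed.

Lemma chain_lt_arith s j x a b d m :
  4 * s * j ^ 2 * x <= m ^ 4 * d -> s * (j ^ 2 * (x * a)) * (4 * b) <= m ^ 4 * a * (d * b).
Proof.
move=> le; have -> : s * (j ^ 2 * (x * a)) * (4 * b) = 4 * s * j ^ 2 * x * (a * b) by ring.
have -> : m ^ 4 * a * (d * b) = m ^ 4 * d * (a * b) by ring.
by rewrite leq_mul2r le orbT.
Qed.

Lemma chain_gt_arith s j x a b d m t : 2 * s * j ^ 2 * x <= m ^ 3 * d * t ->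
  s * (j ^ 2 * (x * a)) * m * (4 * b) <= m ^ 4 * a * (2 * (d * b) * t).
Proof.
move=> le; have -> : s * (j ^ 2 * (x * a)) * m * (4 * b) =
    2 * s * j ^ 2 * x * (2 * m * a * b) by ring.
have -> : m ^ 4 * a * (2 * (d * b) * t) = m ^ 3 * d * t * (2 * m * a * b) by ring.
by rewrite leq_mul2r le orbT.
Qed.

Lemma odd_chain_lt p m j u : 2 < p -> 0 < j -> j <= p.-1 -> u * p.-1 <= m ->
  4 * step_cost p * j ^ 2 * u ^ 4 <= m ^ 4 * 4.
Proof.
move=> p2 j0 jp um; have -> : 4 * step_cost p * j ^ 2 * u ^ 4 =
    step_cost p * j ^ 2 * u ^ 4 * 4 by ring.
by rewrite leq_mul2r cost_sq_exp4_leq.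
Qed.

Lemma odd_chain_gt p m j u : 2 < p -> 0 < j -> j <= p.-1 -> u * p.-1 <= m ->
  2 * step_cost p * j ^ 2 * u ^ 4 <= m ^ 3 * 4 * (u * j).
Proof.
move=> p2 j0 jp um; have le := cost_exp3_leq p2 j0 jp um.
have -> : 2 * step_cost p * j ^ 2 * u ^ 4 = step_cost p * j * u ^ 3 * (2 * (u * j)) by ring.
have -> : m ^ 3 * 4 * (u * j) = 2 * m ^ 3 * (2 * (u * j)) by ring.
by rewrite leq_mul2r le orbT.
Qed.

Lemma two_chain_lt m u : u <= m -> 4 * 4 * 1 ^ 2 * u ^ 4 <= m ^ 4 * 16.
Proof. by move=> um; rewrite muln1 mulnC leq_mul2r leq_exp2r. Qed.

Lemma two_chain_gt m u : u <= m -> 2 * 4 * 1 ^ 2 * u ^ 4 <= m ^ 3 * 16 * (u * 1).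
Proof.
move=> um; have -> : 2 * 4 * 1 ^ 2 * u ^ 4 = u ^ 3 * (8 * u) by ring.
have -> : m ^ 3 * 16 * (u * 1) = m ^ 3 * (16 * u) by ring.
by rewrite leq_mul ?leq_exp2r // leq_mul2r orbT.
Qed.

Lemma two_chain_half m u : 2 * u <= m -> 2 * 4 * 1 ^ 2 * u ^ 4 <= m ^ 3 * 4 * (u * 1).
Proof.
move=> um; have -> : 2 * 4 * 1 ^ 2 * u ^ 4 = (2 * u) ^ 3 * u by ring.
have -> : m ^ 3 * 4 * (u * 1) = m ^ 3 * (4 * u) by ring.
by rewrite leq_mul ?leq_exp2r // leq_pmull.
Qed.

Lemma one_chain_lt m p j : 1 < p -> p <= m -> 0 < j -> j <= p.-1 ->
  4 * step_cost p * j ^ 2 * 1 <= m ^ 4 * 1.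
Proof. by move=> *; rewrite !muln1; apply: four_cost_sq_leq. Qed.

Lemma one_chain_gt m p j : 1 < p -> p <= m -> 0 < j -> j <= p.-1 ->
  2 * step_cost p * j ^ 2 * 1 <= m ^ 3 * 1 * (1 * j).
Proof.
move=> p1 pm j0 jp; have le := two_cost_leq p1 pm j0 jp.
have -> : 2 * step_cost p * j ^ 2 * 1 = 2 * step_cost p * j * j by ring.
by rewrite muln1 mul1n leq_mul2r le orbT.
Qed.

Lemma mersenne_lt q j : 2 < q -> 0 < j -> j <= q.-1 ->
  4 * 4 * 1 ^ 2 * (step_cost q * j ^ 2) <= q.+1 ^ 4 * 1.
Proof.
move=> q2 j0 jq; have le := cost_sq_leq_succ q2 j0 jq.
have -> : 4 * 4 * 1 ^ 2 * (step_cost q * j ^ 2) = 16 * step_cost q * j ^ 2 by ring.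
by rewrite muln1.
Qed.

Lemma mersenne_gt q j : 2 < q -> 0 < j -> j <= q.-1 ->
  4 * 4 * 1 ^ 2 * (step_cost q * j ^ 2 * q) <= q.+1 ^ 4 * (2 * j).
Proof.
move=> q2 j0 jq; have le := cost_mul_leq_succ q2 j0 jq.
have -> : 4 * 4 * 1 ^ 2 * (step_cost q * j ^ 2 * q) = 8 * step_cost q * j * q * (2 * j) by ring.
by rewrite leq_mul2r le orbT.
Qed.

Lemma double_gt_succ u : 1 < u -> (2 * u <= u.+1) = false.
Proof. by lia. Qed.

Lemma mersenne_perm1 s j q a : s * j * q * a = s * (j * a) * q.
Proof. by ring. Qed.

(** Here w is [sopfr] of the group order, and 288 = 4 (2 * 4 + 64). *)
Lemma diam_arith n w : 0 < n -> w <= 4 * n -> w * (2 * w + 64 * n ^ 4) <= 288 * n ^ 5.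
Proof.
move=> n0 lew; have -> : 288 * n ^ 5 = 4 * n * (2 * (4 * n ^ 4) + 64 * n ^ 4) by ring.
rewrite leq_mul // leq_add2r leq_mul2l /= (leq_trans lew) // leq_mul2l /=.
by rewrite -[X in X <= _]expn1 leq_pexp2l.
Qed.

Import GroupScope.

(** * Word balls *)

Section Balls.
Variables (gT : finGroupType) (X : {set gT}).
Implicit Types (g h w y : gT) (M S T G : {group gT}).

(** The identity is added to the alphabet so that k bounds the length and balls are nested. *)
Definition ball k : {set gT} := (1 |: (X :|: X^-1)) ^+ k.

Lemma group1_ball k : 1 \in ball k.
Proof.
rewrite /ball; elim: k => [|k IHk]; first by rewrite expg0 set11.
by rewrite expgS; apply/mulsgP; exists 1 1; rewrite ?setU11 ?mulg1.
Qed.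

Lemma ballM j k g h : g \in ball j -> h \in ball k -> g * h \in ball (j + k).
Proof. by rewrite /ball expgD; apply: mem_mulg. Qed.

Lemma sub_ball j k g : j <= k -> g \in ball j -> g \in ball k.
Proof.
by move=> /subnKC <- gj; rewrite -(mulg1 g) ballM ?group1_ball.
Qed.

Lemma ballV k g : g \in ball k -> g^-1 \in ball k.
Proof.
rewrite /ball; elim: k g => [|k IHk] g.
  by rewrite expg0 => /set1gP ->; rewrite invg1 set11.
rewrite expgS => /mulsgP[x y Xx Xy ->]; rewrite -expgS expgSr invMg mem_mulg ?IHk //.
by move: Xx; rewrite !inE invgK eq_invg1 => /or3P[] ->; rewrite ?orbT.
Qed.

Lemma ballX l a y : y \in ball l -> y ^+ a \in ball (a * l).
Proof.
by move=> yl; elim: a => [|a IHa]; rewrite ?group1_ball // expgS mulSn ballM.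
Qed.

Lemma ballJ l r y w : y \in ball l -> w \in ball r -> y ^ w \in ball (l + 2 * r).
Proof.
move=> yl wr; apply: (@sub_ball (r + (l + r))); first by lia.
by rewrite conjgE !ballM ?ballV.
Qed.

Lemma ballR l r y w :
  y \in ball l -> w \in ball r -> [~ y, y ^ w] \in ball (4 * l + 4 * r).
Proof.
move=> yl wr; have ywl := ballJ yl wr.
apply: (@sub_ball (l + ((l + 2 * r) + (l + (l + 2 * r))))); first by lia.
exact: ballM (ballV yl) (ballM (ballV ywl) (ballM yl ywl)).
Qed.

Lemma mem_ball1 x : x \in X -> x \in ball 1.
Proof. by move=> Xx; rewrite /ball expg1 !inE Xx orbT. Qed.

Lemma ball_wordn k g : g \in ball k -> exists2 j, j <= k & wordn X g j.
Proof.
rewrite /ball; elim: k g => [|k IHk] g.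
  by rewrite expg0 => /set1gP->; exists 0; rewrite ?/wordn ?expg0 ?set11.
rewrite expgS => /mulsgP[x y /setU1P[->|Xx] /IHk[j lejk wj] ->].
  by exists j; rewrite ?mul1g // leqW.
by exists j.+1; rewrite // /wordn expgS mem_mulg.
Qed.

Lemma ball_sub_gen k : ball k \subset <<X>>.
Proof.
apply/subsetP=> g /ball_wordn[j _ wj]; apply/wordP; by exists j.
Qed.

End Balls.

(** Turns commuting with y modulo M into membership in a subgroup, which can then be tested on
    generators. *)
Lemma commg_cosetE (gT : finGroupType) (M : {group gT}) (y h : gT) :
  y \in 'N(M) -> h \in 'N(M) -> ([~ y, h] \in M) = (h \in coset M @*^-1 'C[coset M y]).
Proof.
move=> Ny Nh; apply/idP/idP=> [Ryh | ].
  apply/morphpreP; split=> //; apply/cent1P/esym/commgP.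
  by rewrite -morphR //= coset_id.
case/morphpreP=> _ /cent1P/esym/commgP/eqP Ryh.
by apply: coset_idr; rewrite ?groupR //= morphR.
Qed.

(** * Normal closures generated by short conjugates *)

Section Chain.
Variables (gT : finGroupType) (X : {set gT}) (G : {group gT}).
Hypothesis genX : <<X>> = G.

Lemma ball_sub k : ball X k \subset G. Proof. by rewrite -genX ball_sub_gen. Qed.

Variables (M : {group gT}) (y : gT).
Hypotheses (nMG : M <| G) (Gy : y \in G).

Definition conj_gen k := <<M :|: [set y ^ w | w in ball X k]>>.

Lemma conj_gen_sub k : conj_gen k \subset G.
Proof.
rewrite gen_subG subUset normal_sub //=; apply/subsetP=> _ /imsetP[w wk ->].
by rewrite groupJ // (subsetP (ball_sub k)).
Qed.

Lemma sub_conj_gen k : M \subset conj_gen k.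
Proof. by rewrite sub_gen ?subsetUl. Qed.

Lemma mem_conj_gen k w : w \in ball X k -> y ^ w \in conj_gen k.
Proof. by move=> wk; rewrite mem_gen // inE imset_f ?orbT. Qed.

Lemma conj_genS k : conj_gen k \subset conj_gen k.+1.
Proof.
rewrite gen_subG subUset sub_conj_gen; apply/subsetP=> _ /imsetP[w wk ->].
by rewrite mem_conj_gen // (sub_ball _ wk).
Qed.

(** If one more letter in the conjugators adds nothing, each element of X normalises the group,
    hence so does G. *)
Lemma conj_gen_stable k : conj_gen k.+1 = conj_gen k ->
  forall g, g \in G -> y ^ g \in conj_gen k.
Proof.
move=> stab g; suff nG : G \subset 'N(conj_gen k).
  move=> Gg; rewrite memJ_norm ?(subsetP nG) //.
  by rewrite -[y]conjg1 mem_conj_gen ?group1_ball.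
rewrite -genX gen_subG; apply/subsetP=> x Xx; rewrite inE.
rewrite -genJ gen_subG conjUg subUset.
have Gx : x \in G by rewrite -genX mem_gen.
rewrite (normsP (normal_norm nMG)) // sub_conj_gen /=.
apply/subsetP=> _ /imsetP[_ /imsetP[w wk ->] ->].
rewrite -/(conj_gen k) -conjgM -stab mem_conj_gen // -addn1 ballM //.
exact: mem_ball1.
Qed.

(* The chain [conj_gen k] is strictly increasing until it stabilises, which
   bounds the length of the conjugators that have to be tried. *)
Lemma conj_gen_full :
  exists2 k, k <= sopfr #|G : M| & forall g, g \in G -> y ^ g \in conj_gen k.
Proof.
set s := sopfr _.
have [/hasP[k] | /hasPn nostab] := boolP (has (fun k => conj_gen k.+1 == conj_gen k) (iota 0 s.+1)).
  by rewrite mem_iota /= ltnS => ks /eqP/conj_gen_stable; exists k.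
(* Each strict inclusion adds at least 1 to [sopfr] of the index over M, so s + 1 of them would
   exceed the value s for G. *)
have grow k : k <= s.+1 -> k <= sopfr #|conj_gen k : M|.
  elim: k => // k IHk lt_ks; apply: leq_ltn_trans (IHk (ltnW lt_ks)) _.
  have nsub : ~~ (conj_gen k.+1 \subset conj_gen k).
    have := nostab k; rewrite mem_iota => /(_ lt_ks).
    by rewrite eqEsubset conj_genS andbT.
  rewrite -(Lagrange_index (conj_genS k) (sub_conj_gen k)) sopfrM ?indexg_gt0 //.
  by rewrite -addn1 addnC leq_add // sopfr_gt0 // indexg_gt1.
have := grow s.+1 (leqnn _); rewrite leqNgt ltnS (sopfr_dvd (indexg_gt0 _ _)) //.
by rewrite -(Lagrange_index (conj_gen_sub s.+1) (sub_conj_gen _)) dvdn_mull.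
Qed.

(** The elements commuting with y modulo M form a group; together with M, the short conjugates of y
    generate a group containing all its conjugates. *)
Lemma commg_conj_ball :
    (forall w, w \in ball X (sopfr #|G : M|) -> [~ y, y ^ w] \in M) ->
  forall g, g \in G -> [~ y, y ^ g] \in M.
Proof.
move=> cyw g Gg; have [k ks full] := conj_gen_full.
have nM := subsetP (normal_norm nMG).
suff /subsetP sub : conj_gen k \subset coset M @*^-1 'C[coset M y].
  have:= sub _ (full _ Gg); by rewrite -commg_cosetE ?nM ?groupJ //.
rewrite gen_subG subUset; apply/andP; split; apply/subsetP=> h.
  move=> Mh; rewrite mem_morphpre ?(subsetP (normG M)) //= coset_id ?group1 //.
case/imsetP=> w wk ->.
have Gw : w \in G by rewrite (subsetP (ball_sub k)).
by rewrite -commg_cosetE ?nM ?groupJ // cyw // (sub_ball ks).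
Qed.

End Chain.

(** * Short elements with elementary abelian normal closure *)

Section Short.
Variables (gT : finGroupType) (X : {set gT}) (G : {group gT}).
Hypothesis genX : <<X>> = G.
Implicit Types (M S T K : {group gT}).

(** Up to conjugation, a commutator of two conjugates of y is one of y with a conjugate, so the
    generators commute modulo M. *)
Lemma conj_gen_commg (M : {group gT}) (y : gT) k :
    M <| G -> y \in G -> (forall g, g \in G -> [~ y, y ^ g] \in M) ->
  {in conj_gen X M y k &, forall a b, [~ a, b] \in M}.
Proof.
move=> nMG Gy cyy; have nM := subsetP (normal_norm nMG).
have sub (a : gT) : a \in G -> (forall w, w \in ball X k -> [~ a, y ^ w] \in M) ->
    {in conj_gen X M y k, forall b, [~ a, b] \in M}.
  move=> Ga ca b Yb; rewrite commg_cosetE ?nM //; last first.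
    exact: (subsetP (conj_gen_sub genX nMG Gy k)).
  apply: subsetP Yb; rewrite gen_subG subUset; apply/andP; split; apply/subsetP=> h.
    move=> Mh; rewrite -commg_cosetE ?nM ?(subsetP (normal_sub nMG) h) //.
    by rewrite commgEr groupM // memJ_norm ?groupV // nM.
  case/imsetP=> w wk ->; have Gw := subsetP (ball_sub genX k) w wk.
  by rewrite -commg_cosetE ?nM ?groupJ // ca.
have flip a b : [~ a, b] \in M -> [~ b, a] \in M by rewrite -invg_comm groupV.
move=> a b Ya Yb; apply/flip; apply: (sub b) Ya.
  exact: (subsetP (conj_gen_sub genX nMG Gy k)).
move=> w wk; apply/flip; have Gw := subsetP (ball_sub genX k) w wk.
apply: (sub (y ^ w)) Yb; rewrite ?groupJ // => v vk.
have Gv := subsetP (ball_sub genX k) v vk.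
rewrite -(conjgKV w (y ^ v)) -conjRg -conjgM memJ_norm ?nM // cyy //.
by rewrite groupM ?groupV.
Qed.

(* The weight [step_cost p] on the length of y pays in advance for replacing y
   by its p-th power or by a commutator at the next step. *)
Definition short_elem S c := forall M, M <| G -> M \proper G -> gcore S G \subset M ->
  exists y p l, [/\ y \in G :\: M, prime p, y \in ball X l, step_cost p * l <= c
    & y ^+ p \in M /\ forall g, g \in G -> [~ y, y ^ g] \in M].

Lemma short_elem_mono S c d : c <= d -> short_elem S c -> short_elem S d.
Proof.
move=> lecd sS M nMG pMG sSM; have [y [p [l [Gy pp yl lc yM]]]] := sS M nMG pMG sSM.
by exists y, p, l; split; rewrite // (leq_trans lc).
Qed.

(* No proper normal subgroup contains the core of G itself. *)
Lemma short_elem_full : short_elem G 0.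
Proof.
move=> M nMG pMG; rewrite subEproper; have -> : gcore G G = G.
  by apply/eqP; rewrite eqEsubset gcore_sub gcore_max ?normG.
by case/orP=> [/eqP e|/proper_sub]; [rewrite e properxx in pMG | rewrite (negPf (proper_subn pMG))].
Qed.

Lemma gcore_mem (S : {group gT}) x :
  (forall g, g \in G -> x ^ g \in S) -> x \in gcore S G.
Proof.
move=> xS; apply/bigcapP=> g Gg; rewrite mem_conjg xS ?groupV //.
Qed.

(** The core D of T in G is elementary abelian modulo M. Unless MD = G, the hypothesis on T gives y
    outside MD that is good modulo MD. If some [y, y^w] or y^q falls outside M, it lies in MD, where
    every element outside M is good; otherwise y itself is good modulo M. *)
Lemma short_elem_step S T K p c :
    prime p -> gcore T G \subset K -> (forall x, x \in K -> x ^+ p \in S) ->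
    {in K &, forall x y, [~ x, y] \in S} -> S \proper G -> S \subset G -> T \subset G ->
  short_elem T c -> short_elem S (step_cost p * (c + 4 * sopfr #|G : gcore S G|)).
Proof.
move=> pp sTK Kp KK pSG sSG sTG sT M nMG pMG sSM.
set D := [group of gcore T G]; have nDG : D <| G by apply: gcore_normal.
have Dp d : d \in D -> d ^+ p \in M.
  move=> Dd; apply: (subsetP sSM); apply: gcore_mem => g Gg.
  by rewrite conjXg Kp // (subsetP sTK) // memJ_norm // (subsetP (normal_norm nDG)).
have DD d e : d \in D -> e \in D -> [~ d, e] \in M.
  move=> Dd De; apply: (subsetP sSM); apply: gcore_mem => g Gg.
  by rewrite conjRg KK // (subsetP sTK) // memJ_norm // (subsetP (normal_norm nDG)).
have nM := subsetP (normal_norm nMG).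
have nMD : D \subset 'N(M) by apply/subsetP=> d Dd; rewrite nM // (subsetP (normal_sub nDG)).
have MDE z : z \in M <*> D -> exists2 d, d \in D & coset M z = coset M d.
  rewrite norm_joinEr // => /mulsgP[m d Mm Dd ->]; exists d => //.
  by rewrite coset_kerl.
have MDp z : z \in M <*> D -> z ^+ p \in M.
  move=> MDz; have [d Dd zd] := MDE z MDz.
  have Nz : z \in 'N(M) by apply: subsetP MDz; rewrite join_subG normG.
  apply: coset_idr; rewrite ?groupX //= morphX //= zd -morphX ?(subsetP nMD) //=.
  by rewrite coset_id ?Dp.
have MDD z t : z \in M <*> D -> t \in M <*> D -> [~ z, t] \in M.
  move=> MDz MDt; have [d Dd zd] := MDE z MDz; have [e De te] := MDE t MDt.
  have Nz : z \in 'N(M) by apply: subsetP MDz; rewrite join_subG normG.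
  have Nt : t \in 'N(M) by apply: subsetP MDt; rewrite join_subG normG.
  apply: coset_idr; rewrite ?groupR //= morphR //= zd te -morphR ?(subsetP nMD) //=.
  by rewrite coset_id ?DD.
have nMDG : M <*> D <| G by rewrite normalY.
have memJ z g : z \in M <*> D -> g \in G -> z ^ g \in M <*> D.
  by move=> MDz Gg; rewrite memJ_norm // (subsetP (normal_norm nMDG)).
set rho := sopfr #|G : gcore S G|; set sp := step_cost p.
have idxM : sopfr #|G : M| <= rho.
  apply: sopfr_dvd; rewrite ?indexg_gt0 //.
  by rewrite -(Lagrange_index (normal_sub nMG) sSM) dvdn_mulr.
have rho0 : 0 < rho by apply: leq_trans idxM; rewrite sopfr_gt0 // indexg_gt1 proper_subn.
have spp : p <= sp by rewrite leq_maxr.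
have sp4 : 4 <= sp by rewrite leq_maxl.
have [pMDG | ] := boolP (M <*> D \proper G); last first.
  rewrite properE (normal_sub nMDG) negbK => sGMD.
  (* Here MD = G, so G / M is elementary abelian and any letter outside M will do. *)
  have /subsetPn[x Xx nMx] : ~~ (X \subset M).
    by apply: contra (proper_subn pMG); rewrite -genX gen_subG.
  have Gx : x \in G by rewrite -genX mem_gen.
  exists x, p, 1%N; split=> //.
  - by rewrite in_setD nMx.
  - exact: mem_ball1.
  - by rewrite leq_mul2l addn_gt0 muln_gt0 rho0 !orbT.
  split; first by rewrite MDp ?(subsetP sGMD).
  by move=> g Gg; rewrite MDD // (subsetP sGMD) ?groupJ.
have sTMD : gcore T G \subset M <*> D by rewrite joing_subr.
have [y [q [l [/setDP[Gy nMDy] pq yl lc [yq yy]]]]] := sT [group of M <*> D] nMDG pMDG sTMD.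
have nMy : y \notin M by apply: contra nMDy; apply: subsetP; rewrite joing_subl.
have l4 : 4 * l <= c by apply: leq_trans lc; rewrite leq_mul2r leq_maxl orbT.
have lq : q * l <= c by apply: leq_trans lc; rewrite leq_mul2r leq_maxr orbT.
(* Only short conjugators are tried; if they all fail, [commg_conj_ball] extends the failure to
   every conjugate. *)
have [/existsP[w /andP[wr nyw]] | /existsPn cyw] :=
    boolP [exists w, (w \in ball X (sopfr #|G : M|)) && ([~ y, y ^ w] \notin M)].
  have Gw := subsetP (ball_sub genX _) _ wr.
  exists [~ y, y ^ w], p, (4 * l + 4 * rho); split=> //.
  - by rewrite in_setD nyw groupR ?groupJ.
  - by apply: ballR => //; apply: sub_ball wr.
  - by rewrite leq_mul2l leq_add2r l4 orbT.
  by split=> [|g Gg]; rewrite ?MDp ?MDD ?memJ ?yy.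
have cyy : forall g, g \in G -> [~ y, y ^ g] \in M.
  apply: (commg_conj_ball genX nMG Gy) => w wr; have := cyw w.
  by rewrite wr negbK.
have [yqM | nyqM] := boolP (y ^+ q \in M).
  exists y, q, l; split=> //; first by rewrite in_setD nMy.
  by rewrite (leq_trans lc) // (leq_trans (leq_addr (4 * rho) c)) // leq_pmull // (leq_trans _ sp4).
exists (y ^+ q), p, (q * l)%N; split=> //.
  - by rewrite in_setD nyqM groupX.
  - exact: ballX.
  - by rewrite leq_mul2l (leq_trans lq) ?orbT // leq_addr.
by split=> [|g Gg]; rewrite ?MDp ?MDD ?memJ ?yy.
Qed.

End Short.

(** * Covering the group by a ball *)

Section Cover.
Variables (gT : finGroupType) (X : {set gT}) (G : {group gT}).
Hypothesis genX : <<X>> = G.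
Implicit Types (M S T K B Y : {group gT}).

Lemma ball_mul j k : ball X j * ball X k = ball X (j + k).
Proof. by rewrite /ball expgD. Qed.

Lemma index_cycle_join B z p :
  prime p -> z \in 'N(B) -> z \notin B -> z ^+ p \in B -> #|B <*> <[z]> : B| = p.
Proof.
move=> pp Nz nBz Bzp; have nB : B <*> <[z]> \subset 'N(B) by rewrite join_subG normG cycle_subG.
rewrite -card_quotient // joingC quotientYidr ?cycle_subG // quotient_cycle //.
have ->: #|<[coset B z]>| = #[coset B z] by [].
apply: nt_prime_order => //; first by rewrite -morphX //= coset_id.
by apply: contra nBz => /eqP; apply: coset_idr.
Qed.

(** Adjoining to B some z of Z outside it multiplies the order by p, and each new element is z^a b
    with a < p, at cost a l + N for z^a, where N pays for the conjugator. The primes p add up to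
    [sopfr] of the index. *)
Lemma cover_elementary M Y (Z : {set gT}) p l N B :
    prime p -> M <| Y -> (forall a b, a \in Y -> b \in Y -> [~ a, b] \in M) ->
    Y = <<M :|: Z>> :> {set gT} ->
    (forall z, z \in Z -> z ^+ p \in M /\ forall a, z ^+ a \in ball X (a * l + N)) ->
    M \subset B -> B \subset Y ->
  forall c, B \subset ball X c * M -> Y \subset ball X (sopfr #|Y : B| * (N + l) + c) * M.
Proof.
move=> pp nMY YY genY Zl sMB; have [n] := ubnP #|Y : B|.
elim: n B sMB => // n IHn B sMB ltn sBY c Bc.
have [sYB | nsYB] := boolP (Y \subset B).
  apply: subset_trans (subset_trans sYB Bc) _; apply: mulSg.
  by apply/subsetP=> g; apply: sub_ball; apply: leq_addl.
have /subsetPn[z Zz nBz] : ~~ (Z \subset B).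
  by apply: contra nsYB => sZB; rewrite genY gen_subG subUset sMB.
have Yz : z \in Y by rewrite genY mem_gen // inE Zz orbT.
have [Mzp zball] := Zl z Zz.
have nBY : Y \subset 'N(B).
  apply/subsetP=> y Yy; rewrite inE; apply/subsetP=> _ /imsetP[b Bb ->].
  by rewrite conjg_mulR groupM // (subsetP sMB) // YY // (subsetP sBY).
have Nz := subsetP nBY z Yz.
pose B' := [group of B <*> <[z]>].
have sB'Y : B' \subset Y by rewrite join_subG sBY cycle_subG.
have sBB' : B \subset B' by rewrite joing_subl.
have ix := index_cycle_join pp Nz nBz (subsetP sMB _ Mzp).
have split_ix := Lagrange_index sB'Y sBB'.
have sIx : sopfr #|Y : B| = sopfr #|Y : B'| + p.
  by rewrite -split_ix sopfrM ?indexg_gt0 // ix (sopfr_prime pp).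
have step : B' \subset ball X (p * (l + N) + c) * M.
  rewrite /= joingC norm_joinEl ?cycle_subG //.
  apply/subsetP=> _ /mulsgP[x b /cycleP[i ->] Bb ->].
  have p0 := prime_gt0 pp.
  (* Powers of z^p are absorbed by B, which leaves an exponent below p. *)
  have Bb' : (z ^+ p) ^+ (i %/ p) * b \in B.
    by rewrite groupM // groupX // (subsetP sMB).
  have -> : z ^+ i * b = z ^+ (i %% p) * ((z ^+ p) ^+ (i %/ p) * b).
    by rewrite mulgA -expgM -expgD addnC mulnC -divn_eq.
  have /mulsgP[h m hc Mm ->] := subsetP Bc _ Bb'.
  rewrite mulgA; apply: mem_mulg => //.
  apply: sub_ball (ballM (zball (i %% p)) hc); rewrite leq_add2r mulnDr.
  by rewrite leq_add // ?leq_mul2r ?(ltnW (ltn_pmod i p0)) ?orbT // leq_pmull.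
have lt' : #|Y : B'| < n.
  rewrite -ltnS; apply: leq_trans ltn; rewrite ltnS -split_ix ix.
  by rewrite -[X in X < _]muln1 ltn_pmul2l ?indexg_gt0 // prime_gt1.
have := IHn B' (subset_trans sMB sBB') lt' sB'Y _ step.
by rewrite sIx mulnDl addnA (addnC N l).
Qed.

(** Induction on |G : M|: with Y the normal closure of a short y over M, cover G modulo Y, then Y
    modulo M. The costs add up because [sopfr] is additive. *)
Lemma ball_cover S c : gcore S G = 1 -> short_elem X G S c ->
  G \subset ball X (sopfr #|G| * (2 * sopfr #|G| + c)).
Proof.
move=> coreS sS; set s := sopfr #|G|.
suff cov M : M <| G -> G \subset ball X (sopfr #|G : M| * (2 * s + c)) * M.
  by have := cov 1%G (normal1 G); rewrite indexg1 mulg1.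
have [n] := ubnP #|G : M|; elim: n M => // n IHn M ltn nMG.
have [pMG | ] := boolP (M \proper G); last first.
  rewrite properE normal_sub //= negbK => sGM; apply: subset_trans sGM _.
  by apply/subsetP=> g Mg; rewrite -(mul1g g) mem_mulg ?group1_ball.
have [|y [p [l [/setDP[Gy nMy] pp yl lc [yp yy]]]]] := sS M nMG pMG.
  by rewrite coreS sub1G.
have [k ks full] := conj_gen_full genX nMG Gy.
pose Y := [group of conj_gen X M y k].
have sYG : Y \subset G := conj_gen_sub genX nMG Gy k.
have sMY : M \subset Y := sub_conj_gen X M y k.
have nYG : Y <| G.
  rewrite /normal sYG; apply/subsetP=> g Gg; rewrite inE /= -genJ gen_subG conjUg subUset.
  rewrite (normsP (normal_norm nMG)) // sMY; apply/subsetP=> _ /imsetP[_ /imsetP[w wk ->] ->].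
  by rewrite -conjgM full // groupM // (subsetP (ball_sub genX k)).
have Yy : y \in Y by rewrite -[y]conjg1 full.
have split_ix := Lagrange_index sYG sMY.
have ltY : #|G : Y| < n.
  rewrite -ltnS; apply: leq_trans ltn; rewrite ltnS -split_ix.
  rewrite -[X in X < _]muln1 ltn_pmul2l ?indexg_gt0 // indexg_gt1.
  by apply/subsetPn; exists y.
have l_c : l <= c.
  by apply: leq_trans lc; rewrite leq_pmull // leq_max.
have ks' : k <= s.
  apply: (leq_trans ks); apply: sopfr_dvd; rewrite ?cardG_gt0 //.
  by rewrite dvdn_indexg.
have covY : Y \subset ball X (sopfr #|Y : M| * (2 * s + l) + 0) * M.
  apply: (@cover_elementary M Y [set y ^ w | w in ball X k] p) => //.
  - exact: normalS sMY sYG nMG.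
  - by move=> a b Ya Yb; apply: conj_gen_commg nMG Gy yy _ _ Ya Yb.
  (* A power of y^w is a conjugate of a power of y, so w is paid for once, whatever the exponent. *)
  - move=> _ /imsetP[w wk ->]; have Gw := subsetP (ball_sub genX k) w wk.
    rewrite -conjXg memJ_norm ?(subsetP (normal_norm nMG)) //; split=> // a.
    rewrite -conjXg; apply: sub_ball (ballJ (ballX a yl) wk).
    by rewrite leq_add2l leq_mul2l ks' orbT.
  by apply/subsetP=> g Mg; rewrite -(mul1g g) mem_mulg ?group1_ball.
apply: subset_trans (IHn Y ltY nYG) _.
apply: subset_trans (mulgS _ covY) _.
rewrite mulgA ball_mul; apply: mulSg; apply/subsetP=> g; apply: sub_ball.
rewrite addn0 -split_ix sopfrM ?indexg_gt0 // mulnDl leq_add2l leq_mul2l.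
by rewrite leq_add2l l_c orbT.
Qed.

End Cover.

Lemma diam_short_elem (gT : finGroupType) (G : {group gT}) (S : {group gT}) c :
    gcore S G = 1 -> (forall X : {set gT}, <<X>> = G -> short_elem X G S c) ->
  diam G <= sopfr #|G| * (2 * sopfr #|G| + c).
Proof.
move=> coreS sS; apply/bigmax_leqP=> X /eqP genX; apply/bigmax_leqP=> g Gg.
have := subsetP (ball_cover genX coreS (sS X genX)) g Gg.
case/ball_wordn=> j lejN wj; case: wlengthP => [k _ kmin | no] /=.
  by apply: leq_trans (kmin j wj) lejN.
by have := no j; rewrite wj.
Qed.

(** * Affine actions *)

(** U is a minimal normal subgroup, and T = US by maximality of S. A subgroup of S normalised by S
    and U is normal in T, hence trivial; this applies to the centraliser of U in S and to the
    intersection of U and S. *)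
Lemma prim_solvable_struct (gT : finGroupType) (T S : {group gT}) :
    solvable T -> maximal S T -> gcore S T = 1 ->
  exists (U : {group gT}) p, [/\ prime p, p.-abelem U, minnormal U T & U \subset T]
    /\ [/\ U * S = T, 'C_T(U) = U & #|U| = #|T : S|].
Proof.
move=> solT maxS coreS; have [pST maxT] := maxgroupP maxS.
have sST := proper_sub pST.
have ntT : T :!=: 1 by apply: contraL pST => /eqP->; rewrite /proper sub1G andbF.
have [U minU sUT] := minnormal_exists ntT (normG T).
have [nUT ntU /is_abelemP[p pp abelU]] := minnormal_solvable minU sUT solT.
have cUU := abelem_abelian abelU.
have core1 (K : {group gT}) : K \subset S -> S \subset 'N(K) -> U \subset 'N(K) ->
    U * S = T -> K :=: 1.
  move=> sKS nKS nKU defT; apply/trivgP; rewrite -coreS gcore_max // -defT mul_subG //.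
have nUS : S \subset 'N(U) := subset_trans sST nUT.
have defT : U * S = T.
  rewrite -norm_joinEr //; have /maximal_eqP[_ /(_ (S <*> U)%G)]: maximal_eq S T.
    by rewrite /maximal_eq maxS orbT.
  rewrite joing_subl join_subG sST sUT => /(_ isT isT)[eS|<-]; last by rewrite /= joingC.
  case/negP: ntU; rewrite -subG1 -coreS gcore_max //.
  by rewrite -eS joing_subr.
exists U, p; split=> //; split=> //.
  have cS1 : S :&: 'C(U) = 1.
    apply: (core1 [group of S :&: 'C(U)]) => //=; first exact: subsetIl.
      by rewrite normsI ?normG // norms_cent.
    by rewrite cents_norm // centsC subsetIr.
  by rewrite -defT -(group_modl S (cUU : U \subset 'C(U)%G)) cS1 mulg1.
have tiUS : U :&: S = 1.
  apply: (core1 [group of U :&: S]) => //=; first exact: subsetIr.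
    by rewrite normsI ?normG.
  by rewrite cents_norm // (subset_trans cUU) // centS // subsetIl.
by rewrite -divgS // -defT (TI_cardMg tiUS) mulnK.
Qed.

(** The powers of p contribute p (k + 'C(k, 2)), and each factor p^i - 1 at most itself; either sum
    is at most 2 (p^k - 1). *)
Lemma sopfr_GL p k : prime p -> 0 < k ->
  sopfr (p ^ k * #|'GL_k['F_p]|) <= 4 * (p ^ k - 1).
Proof.
move=> pp k0; have p1 := prime_gt1 pp; have p0 := prime_gt0 pp.
have ge1 i : 0 < i -> 0 < p ^ i - 1.
  by move=> i0; rewrite subn_gt0 -[X in X < _](expn0 p) ltn_exp2l.
have prod_gt0 m : 0 < \prod_(1 <= i < m.+1) (p ^ i - 1).
  elim: m => [|m IHm]; first by rewrite big_geq.
  by rewrite big_nat_recr //= muln_gt0 IHm ge1.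
rewrite card_GL // card_Fp // !sopfrM ?muln_gt0 ?expn_gt0 ?p0 ?prod_gt0 //.
rewrite !sopfrX // !(sopfr_prime pp).
have prodle m : sopfr (\prod_(1 <= i < m.+1) (p ^ i - 1)) <= 2 * (p ^ m - 1).
  elim: m => [|m IHm]; first by rewrite big_geq // sopfr1.
  rewrite big_nat_recr //= sopfrM ?ge1 // expnS.
  have := sopfr_leq (ge1 m.+1 isT); rewrite expnS.
  have : 0 < p ^ m by rewrite expn_gt0 p0.
  by nia.
have bin m : m * p + 'C(m, 2) * p <= 2 * (p ^ m - 1).
  elim: m => [|m IHm]; first by [].
  rewrite binS bin1 expnS.
  have : 0 < p ^ m by rewrite expn_gt0 p0.
  have : m < p ^ m by rewrite ltn_expl.
  case: m IHm => [|m]; first by rewrite expn0 /=; nia.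
  by nia.
by have := prodle k; have := bin k; lia.
Qed.

(** As U is its own centraliser, T / U embeds in the general linear group of U. *)
Lemma sopfr_prim_solvable (gT : finGroupType) (T S : {group gT}) :
  solvable T -> maximal S T -> gcore S T = 1 -> sopfr #|T| <= 4 * (#|T : S| - 1).
Proof.
move=> solT maxS coreS.
have [U [p [[pp abelU minU sUT] [_ cTU <-]]]] := prim_solvable_struct solT maxS coreS.
have /andP[ntU nUT] := mingroupp minU.
have pU := abelem_pgroup abelU.
(* [abelem_dim' U] is the dimension of U minus one. *)
have dU := dim_abelemE abelU ntU.
pose rG := abelem_repr abelU ntU nUT.
have cardU : #|U| = (p ^ (abelem_dim' U).+1)%N by rewrite dU; apply: card_pgroup.
rewrite cardU; apply: leq_trans (sopfr_GL pp (ltn0Sn _)).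
apply: sopfr_dvd; first by rewrite muln_gt0 expn_gt0 (prime_gt0 pp) cardG_gt0.
rewrite -cardU -(Lagrange sUT) dvdn_pmul2l ?cardG_gt0 //.
have -> : #|T : U| = #|reprGLm rG @* T|.
  by rewrite card_morphim ker_reprGLm rker_abelem cTU setIid.
by rewrite cardSg ?subsetT.
Qed.

(** * Cores of subgroups and their indices *)

Section Core.
Variable gT : finGroupType.
Implicit Types S T G L K : {group gT}.

Lemma maximal_above S G : S \proper G -> exists2 T : {group gT}, maximal S T & T \subset G.
Proof.
move=> pSG; have [T /mingroupP[pST minT] sTG] := mingroup_exists (gP := fun H => S \proper H) pSG.
exists T => //; apply/maxgroupP; split=> // H pHT sSH.
move: (sSH); rewrite subEproper => /predU1P[-> //|pSH].
by have eHT := minT H pSH (proper_sub pHT); rewrite eHT properxx in pHT.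
Qed.

Lemma gcoreS S T G : S \subset T -> S \subset G -> gcore S G \subset gcore T G.
Proof. by move=> sST sSG; rewrite gcore_max ?gcore_norm // (subset_trans _ sST) ?gcore_sub. Qed.

Lemma gcore_quotient S T : S \subset T -> gcore (S / gcore S T) (T / gcore S T) = 1.
Proof.
move=> sST; pose L := [group of gcore S T]; have nLT : L <| T by apply: gcore_normal.
have nLS : L <| S := normalS (gcore_sub S T) sST nLT.
rewrite -[gcore S T]/(gval L); apply/trivgP; rewrite -cosetpreSK cosetpre1 gcore_max //.
  by apply: (@subset_trans _ _ (coset L @*^-1 (S / L))); rewrite ?cosetpreSK ?gcore_sub ?quotientGK.
apply: (@subset_trans _ _ (coset L @*^-1 (T / L))); first by rewrite quotientGK.
exact: subset_trans (morphpreS _ (gcore_norm _ _)) (morphpre_norm _ _).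
Qed.

Lemma maximal_quotient_core S T :
  maximal S T -> maximal (S / gcore S T) (T / gcore S T).
Proof.
move=> maxS; have sST := proper_sub (maxgroupp maxS).
have nLT : gcore S T <| T by apply: gcore_normal.
have nLS : gcore S T <| S := normalS (gcore_sub S T) sST nLT.
by rewrite quotient_maximal.
Qed.

Lemma sopfr_maximal S T : solvable T -> maximal S T ->
  sopfr #|T : gcore S T| <= 4 * (#|T : S| - 1).
Proof.
move=> solT maxS; have sST := proper_sub (maxgroupp maxS).
have nLT : gcore S T <| T by apply: gcore_normal.
rewrite -(card_quotient (normal_norm nLT)).
rewrite -(index_quotient_eq (K := S) (G := T) (H := gcore S T)) ?normal_norm //.
  apply: sopfr_prim_solvable; rewrite ?quotient_sol //.
    exact: maximal_quotient_core.
  exact: gcore_quotient.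
by rewrite subIset // gcore_sub orbT.
Qed.

(** Intersecting successively with the conjugates of L, each step has an index dividing |T : L|,
    since the quotient embeds in a conjugate of T / L. *)
Lemma sopfr_conj_cap K L T (r : seq gT) : L <| T ->
    (forall g, g \in r -> K \subset T :^ g) ->
  exists E : {group gT}, [/\ E \subset K, forall g, g \in r -> E \subset L :^ g
    & sopfr #|K : E| <= size r * sopfr #|T : L|].
Proof.
move=> nLT; elim: r => [|g r IHr] sKT; first by exists K; split; rewrite // indexgg sopfr1.
have [|E [sEK sEL leE]] := IHr; first by move=> h rh; rewrite sKT // inE rh orbT.
have sET : E \subset T :^ g by rewrite (subset_trans sEK) // sKT ?mem_head.
have nLg : L :^ g <| T :^ g by rewrite normalJ.
exists (E :&: L :^ g)%G; split=> /=.
- by rewrite subIset ?sEK.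
- move=> h; rewrite inE => /predU1P[-> | rh]; first by rewrite subsetIr.
  by rewrite subIset // sEL.
rewrite -(Lagrange_index sEK (subsetIl _ _)) sopfrM ?indexg_gt0 //.
rewrite mulSn addnC leq_add //; apply: sopfr_dvd; rewrite ?indexg_gt0 //.
rewrite -(indexJg T L g).
have nE : E \subset 'N(L :^ g) := subset_trans sET (normal_norm nLg).
rewrite indexgI -card_quotient // -(card_quotient (normal_norm nLg)).
by rewrite cardSg // quotientS.
Qed.

(** Induction over T minimal above S: passing from the core of T to that of S needs |G : T|
    conjugates of the core of S in T. The bound telescopes, as (k - 1) + k (m - 1) = k m - 1. *)
Lemma sopfr_core S G : solvable G -> S \subset G ->
  sopfr #|G : gcore S G| <= 4 * (#|G : S| - 1).
Proof.
move=> solG; have [n] := ubnP #|G : S|; elim: n S => // n IHn S ltn sSG.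
have [/eqP eSG | neSG] := boolP (S == G :> {set gT}).
  have -> : gcore S G = G.
    by apply/eqP; rewrite eqEsubset gcore_max ?normG ?eSG // gcore_sub.
  by rewrite indexgg sopfr1.
have pSG : S \proper G by rewrite properEneq neSG.
have [T maxS sTG] := maximal_above pSG; have [pST _] := maxgroupP maxS.
have sST := proper_sub pST; have split_ix := Lagrange_index sTG sST.
have m1 : 1 < #|T : S| by rewrite indexg_gt1 proper_subn.
have n0 : 0 < #|G : T| by rewrite indexg_gt0.
have ltT : #|G : T| < n by rewrite -ltnS; apply: leq_trans ltn; rewrite -split_ix ltnS ltn_Pmulr.
have IH := IHn T ltT sTG.
pose r := [seq repr A | A <- enum (rcosets T G)].
have sKG : gcore T G \subset G := subset_trans (gcore_sub T G) sTG.
have [||E [sEK sEL leE]] := @sopfr_conj_cap [group of gcore T G] [group of gcore S T] T r.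
- exact: gcore_normal.
- move=> _ /mapP[A /[1!mem_enum] /rcosetsP[g Gg ->] ->].
  have /rcosetP[t Tt ->] := mem_repr_rcoset T g.
  by rewrite conjsgM conjGid //= bigcap_inf.
(* The conjugate by g of the core of S in T depends only on the coset of g, so representatives
   suffice. *)
have sEC : E \subset gcore S G.
  apply/bigcapsP=> g Gg; apply: subset_trans (_ : gcore S T :^ g \subset _); last first.
    by rewrite conjSg gcore_sub.
  have /rcosetP[t Tt def_r] := mem_repr_rcoset T g.
  have := sEL (repr (T :* g)); rewrite def_r conjsgM /= (normsP (gcore_norm S T)) //; apply.
  by rewrite -def_r; apply: map_f; rewrite mem_enum; apply/rcosetsP; exists g.
have sCK : gcore S G \subset gcore T G by apply: gcoreS.
have leC : sopfr #|gcore T G : gcore S G| <= #|G : T| * (4 * (#|T : S| - 1)).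
  apply: leq_trans (_ : sopfr #|gcore T G : E| <= _).
    apply: sopfr_dvd; rewrite ?indexg_gt0 //.
    by rewrite -(Lagrange_index sCK sEC) dvdn_mulr.
  apply: leq_trans leE _; rewrite size_map -cardE leq_mul2l.
  by rewrite sopfr_maximal ?orbT // (solvableS sTG).
rewrite -(Lagrange_index sKG sCK) sopfrM ?indexg_gt0 // -split_ix.
exact: leq_index_arith.
Qed.

End Core.

(** Stated by membership rather than in a quotient, since S need not be normal in T. *)
Definition elem_step (gT : finGroupType) p (S S1 T : {group gT}) :=
  {in gcore S1 T, forall x, x ^+ p \in S} /\ {in gcore S1 T &, forall x y, [~ x, y] \in S}.

(* S1 is the stabiliser of a vector of the affine space on which T acts with point
   stabiliser S, and N is the stabiliser of the line through this vector. The
   vector has an orbit of minimal size, whence [ac_t]. *)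
Record affine_chain (gT : finGroupType) (S T S1 N : {group gT}) p k : Prop := AffineChain {
  ac_prime : prime p;
  ac_index : #|T : S| = (p ^ k)%N;
  ac_k : 0 < k;
  ac_sub1 : S1 \subset N;
  ac_sub : N \subset T;
  ac_comm : {in N &, forall x y, [~ x, y] \in S1};
  ac_j : #|N : S1| <= p.-1;
  ac_u : #|T : N| * p.-1 <= (#|T : S|).-1;
  ac_k1 : k = 1%N -> N = T;
  ac_t : 2 * #|T : S1| < #|T : S| \/ #|T : S1| = (#|T : S|).-1;
  ac_step : elem_step p S S1 T }.

(* Distinct lines share no nonzero vector. *)
Lemma lines_leq (gT : finGroupType) (U T : {group gT}) p v :
    prime p -> p.-abelem U -> T \subset 'N(U) -> v \in U^# ->
  #|T : 'N_T(<[v]>)| * p.-1 <= #|U^#|.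
Proof.
move=> pp abU nUT /setD1P[ntv Uv]; pose C : {set {set gT}} := <[v]> :^: T.
have le1 (A : {set gT}) : A \in C -> p.-1 <= \sum_(x in U^# | <[x]> == A) 1.
  case/imsetP=> t Tt ->; rewrite sum1_card -cycleJ.
  have Uvt : v ^ t \in U by rewrite memJ_norm // (subsetP nUT).
  have ov : #[v ^ t] = p by apply: (abelem_order_p abU) => //; rewrite conjg_eq1.
  rewrite -[X in X.-1]ov /order (cardsD1 1) group1 /= subset_leq_card //.
  apply/subsetP=> x /setD1P[ntx vx].
  have Ux : x \in U by apply: subsetP vx; rewrite cycle_subG.
  apply/andP; split; first by rewrite in_setD1 ntx.
  rewrite eqEcard cycle_subG vx /= -!orderE ov.
  by rewrite (abelem_order_p abU).
have le2 : \sum_(A in C) p.-1 <= \sum_(x in U^#) 1.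
  apply: (@leq_trans (\sum_(A in C) \sum_(x in U^# | <[x]> == A) 1)).
    apply: leq_sum => A CA. exact: le1.
  rewrite (exchange_big_dep (mem U^#)) //=; last by move=> A x _ /andP[].
  apply: leq_sum => x Ux; rewrite sum1_card -(cards1 <[x]>) subset_leq_card //.
  by apply/subsetP=> A /andP[_ /andP[_ /eqP <-]]; apply: set11.
by rewrite sum_nat_const sum1_card card_conjugates in le2.
Qed.
(** T acts on U by conjugation; v is a nontrivial element with smallest orbit, S1 its centraliser
    and N the normaliser of its line. N acts on the line by scalars with kernel S1, so N / S1 is
    abelian of order at most p - 1. *)
Lemma affine_chain_prim (gT : finGroupType) (T S : {group gT}) :
    solvable T -> maximal S T -> gcore S T = 1 ->
  exists (S1 N : {group gT}) p k, affine_chain S T S1 N p k.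
Proof.
move=> solT maxS coreS.
have [U [p [[pp abU minU sUT] [_ cTU cardU]]]] := prim_solvable_struct solT maxS coreS.
have /andP[ntU nUT] := mingroupp minU; have pU := abelem_pgroup abU.
have [_ _ [k def_m]] := pgroup_pdiv pU ntU.
have cardU1 : #|U^#| = (#|U|).-1 by rewrite (cardsD1 1 U) group1.
have /trivgPn[v0 Uv0 ntv0] := ntU.
have Uv0' : v0 \in U^# by rewrite !inE ntv0.
pose v := [arg min_(x < v0 in U^#) #|x ^: T|].
have [Uv' minv] : v \in U^# /\ forall x, x \in U^# -> #|v ^: T| <= #|x ^: T|.
  by rewrite /v; case: arg_minnP => // x Ux minx; split.
have /setD1P[ntv Uv] := Uv'.
have ov : #[v] = p := abelem_order_p abU Uv ntv.
pose S1 := [group of 'C_T[v]]; pose N := [group of 'N_T(<[v]>)].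
have cN : 'C[v] \subset 'N(<[v]>) by rewrite -cent_cycle cent_sub.
have sS1N : S1 \subset N by rewrite setIS.
have powN x : x \in N -> exists a, v ^ x = v ^+ a.
  case/setIP=> _ nx; apply/cycleP; rewrite memJ_norm ?cycle_id //.
have vclassU : v ^: T \subset U^#.
  apply/subsetP=> _ /imsetP[t Tt ->]; rewrite in_setD1 conjg_eq1 ntv.
  by rewrite memJ_norm // (subsetP nUT).
have idxS1 : #|T : S1| = #|v ^: T| by rewrite index_cent1.
exists S1, N, p, k.+1; split=> //=.
- by rewrite -cardU def_m.
- exact: subsetIl.
(* Both inverses act on the line as power maps, which commute, so the commutator fixes v. *)
- move=> x y Nx Ny; have [[a va] [b vb]] := (powN _ (groupVr Nx), powN _ (groupVr Ny)).
  have Txy : [~ x, y] \in T by rewrite groupR ?(subsetP (subsetIl T 'N(<[v]>))).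
  rewrite inE Txy; apply/cent1P/esym/commgP/conjg_fixP.
  have vxy : v ^ (x^-1 * y^-1) = v ^ (y^-1 * x^-1).
    by rewrite !conjgM va vb !conjXg va vb -!expgM mulnC.
  have -> : [~ x, y] = (x^-1 * y^-1) * (y^-1 * x^-1)^-1.
    by rewrite invMg !invgK commgEl conjgE !mulgA.
  by rewrite conjgM vxy -conjgM mulgV conjg1.
- have -> : 'C_T[v] = 'C_N[v] by rewrite /= -setIA (setIidPr cN).
  rewrite index_cent1 -[X in X.-1]ov /order (cardsD1 1 <[v]>) group1 /= subset_leq_card //.
  apply/subsetP=> _ /imsetP[x Nx ->]; rewrite in_setD1 conjg_eq1 ntv.
  by have [a ->] := powN x Nx; apply: mem_cycle.
- by rewrite -cardU -cardU1; apply: lines_leq.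
- case=> k0; apply/val_inj/setIidPl; rewrite /= (_ : <[v]> = U) //.
  apply/eqP; rewrite eqEcard cycle_subG Uv -orderE ov.
  by rewrite def_m k0 expn1 leqnn.
(* A second orbit is at least as large as that of v, so twice the latter stays below |U|. *)
- have [/eqP eU | neU] := boolP (v ^: T == U^#); [right | left].
    by rewrite idxS1 eU cardU1 cardU.
  have /subsetPn[x Ux nx] : ~~ (U^# \subset v ^: T).
    by apply: contra neU => sU; rewrite eqEsubset vclassU.
  have xclassU : x ^: T \subset U^#.
    have /setD1P[ntx Ux'] := Ux.
    apply/subsetP=> _ /imsetP[t Tt ->]; rewrite in_setD1 conjg_eq1 ntx.
    by rewrite memJ_norm // (subsetP nUT).
  have dis : [disjoint v ^: T & x ^: T].
    rewrite -setI_eq0; apply/eqP/setP=> y; rewrite in_set0; apply/negbTE/negP.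
    by case/setIP=> /class_eqP e1 /class_eqP e2; rewrite -e1 e2 class_refl in nx.
  have : #|v ^: T :|: x ^: T| <= #|U^#| by rewrite subset_leq_card // subUset vclassU.
  have -> : #|v ^: T :|: x ^: T| = #|v ^: T| + #|x ^: T|.
    by apply/eqP; rewrite (leq_card_setU (v ^: T) (x ^: T)).
  rewrite idxS1 cardU1 -cardU => le; have := leq_trans (leq_add (leqnn _) (minv x Ux)) le.
  by rewrite addnn -mul2n -ltnS prednK ?cardG_gt0.
(* The part of U centralised by the core is normal in T and contains v, so it is U by minimality;
   and U is its own centraliser. *)
have coreU : gcore S1 T \subset U.
  rewrite -cTU subsetI (subset_trans (gcore_sub _ _) (subsetIl _ _)) /=.
  have nCT : T \subset 'N(U :&: 'C(gcore S1 T)).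
    by rewrite normsI // norms_cent // gcore_norm.
  rewrite centsC; apply/setIidPl/(mingroupP minU).2 => //=; last exact: subsetIl.
  rewrite nCT andbT; apply/trivgPn; exists v => //.
  rewrite inE Uv; apply/centP=> x /(subsetP (gcore_sub _ _)) /setIP[_ /cent1P cvx].
  exact: commute_sym.
split=> [x Kx | x y Kx Ky].
  by rewrite (proj2 (elimT (abelemP pp) abU)) ?group1 // (subsetP coreU).
have /commgP/eqP-> : commute x y by apply: (centsP (abelem_abelian abU)); apply: (subsetP coreU).
exact: group1.
Qed.

Lemma affine_chain_exists (gT : finGroupType) (T S : {group gT}) :
    solvable T -> maximal S T ->
  exists (S1 N : {group gT}) p k, affine_chain S T S1 N p k.
Proof.
move=> solT maxS; have sST := proper_sub (maxgroupp maxS).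
pose L := [group of gcore S T].
have nLT : L <| T by apply: gcore_normal.
have sLS : L \subset S := gcore_sub S T.
have nLS : L <| S := normalS sLS sST nLT.
have [S1 [N [p [k [pp idx k0 sS1N sNT comm j u k1 t [stepX stepR]]]]]] :=
  affine_chain_prim (quotient_sol L solT) (maximal_quotient_core maxS) (gcore_quotient sST).
pose pre (H : {group coset_of L}) := [group of coset L @*^-1 H].
have preT : coset L @*^-1 (T / L) = T by apply: quotientGK.
have preS : coset L @*^-1 (S / L) = S by apply: quotientGK.
have nT x : x \in T -> x \in 'N(L) := subsetP (normal_norm nLT) x.
have idxT (H : {group coset_of L}) : #|T : pre H| = #|T / L : H|.
  by rewrite -{1}preT index_cosetpre.
have idxTS : #|T : S| = #|T / L : S / L| by rewrite -(idxT (S / L)%G) /= preS.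
have sPre (H : {group coset_of L}) : H \subset T / L -> pre H \subset T.
  by rewrite -cosetpreSK preT.
have sNpreT := sPre N sNT.
have core x : x \in gcore (pre S1) T -> coset L x \in gcore S1 (T / L) /\ x \in 'N(L).
  move=> Cx; have Tx : x \in T.
    apply: subsetP Cx; apply: subset_trans (gcore_sub _ _) _.
    exact: sPre (subset_trans sS1N sNT).
  split; last exact: nT.
  have: coset L x \in gcore (pre S1) T / L by rewrite mem_quotient.
  apply: subsetP; rewrite gcore_max ?quotient_norms ?gcore_norm //.
  by rewrite -(cosetpreK S1) quotientS // gcore_sub.
exists (pre S1), (pre N), p, k; split=> //.
- by rewrite idxTS.
- by rewrite cosetpreSK.
- move=> x y Nx Ny; have [Tx Ty] := (subsetP sNpreT x Nx, subsetP sNpreT y Ny).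
  rewrite mem_morphpre ?groupR ?nT //= morphR ?nT //=.
  by apply: comm; [case/morphpreP: Nx | case/morphpreP: Ny].
- by rewrite index_cosetpre.
- by rewrite idxT idxTS.
- by move/k1=> eN; apply/val_inj; rewrite /= eN.
- by rewrite idxT idxTS.
split=> [x | x y] /core[Cx Nx] => [|/core[Cy Ny]].
  have := stepX _ Cx; rewrite -morphX //= => Sx.
  by rewrite -preS mem_morphpre ?groupX.
have := stepR _ _ Cx Cy; rewrite -morphR //= => Sxy.
by rewrite -preS mem_morphpre ?groupR.
Qed.

(** * Descent on the index *)

Section Bound.
Variables (gT : finGroupType) (X : {set gT}) (G : {group gT}).
Hypotheses (genX : <<X>> = G) (solG : solvable G).
Implicit Types (S T N : {group gT}).

(* The quantity c + 64 |G : S| is at most a / b: the additive losses of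
   [short_elem_step] are absorbed by the term 64 |G : S|, so that each step is
   purely multiplicative. *)
Definition cost_bound S a b := exists2 c, short_elem X G S c & b * (c + 64 * #|G : S|) <= a.

Lemma cost_bound_weaken S a b a' b' :
  0 < b -> a * b' <= a' * b -> cost_bound S a b -> cost_bound S a' b'.
Proof.
move=> b0 le [c sS lea]; exists c => //; rewrite -(leq_pmul2l b0).
rewrite mulnCA (mulnC b a'); apply: leq_trans le; rewrite mulnC leq_mul2r.
by rewrite lea orbT.
Qed.

(** While the index drops at most by half, the slack in 64 |G : S1| covers the additive loss; beyond
    that, the factor m / (2 t) is paid. *)
Lemma cost_bound_step p S S1 T a b : prime p -> elem_step p S S1 T ->
    S \proper T -> S1 \subset T -> T \subset G -> cost_bound S1 a b ->
  (#|T : S| <= 2 * #|T : S1| -> cost_bound S (step_cost p * a) b) /\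
  (2 * #|T : S1| <= #|T : S| -> cost_bound S (step_cost p * a * #|T : S|) (2 * b * #|T : S1|)).
Proof.
move=> pp [stepX stepR] pST sS1T sTG [c sS1 lea].
have sST := proper_sub pST; have sSG := subset_trans sST sTG.
have sS1G := subset_trans sS1T sTG.
have pSG : S \proper G := proper_sub_trans pST sTG.
have sCC : gcore S1 G \subset gcore S1 T.
  by rewrite gcore_max ?gcore_sub // (subset_trans sTG) // gcore_norm.
have := short_elem_step genX pp sCC stepX stepR pSG sSG sS1G sS1.
set rho := sopfr _ => sS.
have lerho : rho <= 4 * #|G : S|.
  by apply: leq_trans (sopfr_core solG sSG) _; rewrite leq_mul2l leq_subr orbT.
have s4 : 4 <= step_cost p by rewrite leq_maxl.
have eS := Lagrange_index sTG sST; have eS1 := Lagrange_index sTG sS1T.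
rewrite -eS1 in lea; split=> le_tm; exists (step_cost p * (c + 4 * rho))%N => //.
  by apply: step_lt_arith lea; rewrite // -eS mulnCA leq_mul2l le_tm orbT.
by rewrite -eS; apply: step_gt_arith lea; rewrite // eS.
Qed.

(** Descent from N to S by steps of prime index q, each losing at most q^2. *)
Lemma cost_bound_abelian S N a b : S \subset N -> N \subset G ->
    {in N &, forall x y, [~ x, y] \in S} ->
  cost_bound N a b -> 0 < b -> cost_bound S (#|N : S| ^ 2 * a) b.
Proof.
move=> + sNG + bN b0; have [n] := ubnP #|N : S|; elim: n S => // n IHn S ltn sSN comm.
have [/eqP eSN | neSN] := boolP (S == N :> {set gT}).
  by rewrite (_ : S = N) ?indexgg ?mul1n //; apply: val_inj.
have pSN : S \proper N by rewrite properEneq neSN.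
have nSN : S <| N.
  rewrite /normal sSN; apply/subsetP=> x Nx; rewrite inE; apply/subsetP=> _ /imsetP[y Sy ->].
  by rewrite conjg_mulR groupM // comm // (subsetP sSN).
have i1 : 1 < #|N / S| by rewrite card_quotient ?normal_norm // indexg_gt1 proper_subn.
have qq := pdiv_prime i1; set q := pdiv _ in qq.
have [x Nx ox] := Cauchy qq (pdiv_dvd _).
pose T := [group of coset S @*^-1 <[x]>].
have sTN : T \subset N by rewrite -(quotientGK nSN) cosetpreSK cycle_subG.
have sST : S \subset T by apply: sub_cosetpre.
have iTS : #|T : S| = q.
  have -> : #|T : S| = #|T : coset S @*^-1 1| by rewrite cosetpre1.
  by rewrite index_cosetpre indexg1 -orderE.
have q1 := prime_gt1 qq.
have sTG := subset_trans sTN sNG.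
have pST : S \proper T by rewrite properE sST -indexg_gt1 iTS q1.
have nT y : y \in T -> y \in 'N(S).
  by move=> Ty; apply: (subsetP (normal_norm nSN)); apply: subsetP Ty.
have step : elem_step q S T T.
  have sgT : {subset gcore T T <= T} by apply/subsetP; apply: gcore_sub.
  split=> [y /sgT Ty | y z /sgT Ty /sgT Tz]; last by apply: comm; apply: (subsetP sTN).
  apply: coset_idr; rewrite ?groupX ?nT // morphX ?nT //=.
  have /cycleP[i ->] : coset S y \in <[x]> by case/morphpreP: Ty.
  by rewrite -expgM mulnC expgM -ox expg_order expg1n.
have split_ix := Lagrange_index sTN sST.
have ltT : #|N : T| < n.
  by rewrite -ltnS; apply: leq_trans ltn; rewrite -split_ix iTS ltnS ltn_Pmulr ?indexg_gt0.
have bT := IHn T ltT sTN (fun y z Ny Nz => subsetP sST _ (comm y z Ny Nz)).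
(* Here T plays the part of S1, so t = 1 and the loss is [step_cost q] * q / 2, at most q^2. *)
have [_] := cost_bound_step qq step pST (subxx T) sTG bT.
rewrite indexgg iTS => /(_ q1); apply: cost_bound_weaken; first by rewrite muln1 muln_gt0 b0.
by rewrite -split_ix iTS; apply: abelian_arith; apply: step_cost_leq2.
Qed.

End Bound.

(** * Recursion along affine chains *)

Section Recursion.
Variables (gT : finGroupType) (X : {set gT}) (G : {group gT}).
Hypotheses (genX : <<X>> = G) (solG : solvable G).
Implicit Types (S T N : {group gT}).
Local Notation cost_bound := (cost_bound X G).

(** The loss from T to N is x / d, that from N to S1 is |N : S1|^2, and [cost_bound_step] gives the
    last one; the two numerical hypotheses keep the total within |T : S|^4 / 4. *)
Lemma cost_bound_chain S T S1 N p k a b x d : affine_chain S T S1 N p k -> S \proper T ->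
    T \subset G -> 0 < b -> 0 < d -> cost_bound N (x * a) (d * b) ->
    (#|T : S| <= 2 * #|T : S1| -> 4 * step_cost p * #|N : S1| ^ 2 * x <= #|T : S| ^ 4 * d) ->
    (2 * #|T : S1| <= #|T : S| ->
       2 * step_cost p * #|N : S1| ^ 2 * x <= #|T : S| ^ 3 * d * #|T : S1|) ->
  cost_bound S (#|T : S| ^ 4 * a) (4 * b).
Proof.
case=> pp _ _ sS1N sNT comm _ _ _ _ step pST sTG b0 d0 bN le_lt le_gt.
have db0 : 0 < d * b by rewrite muln_gt0 d0.
have bS1 := cost_bound_abelian genX solG sS1N (subset_trans sNT sTG) comm bN db0.
have [b_lt b_gt] := cost_bound_step genX solG pp step pST (subset_trans sS1N sNT) sTG bS1.
have [le | lt] := leqP #|T : S| (2 * #|T : S1|).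
  by apply: cost_bound_weaken (b_lt le) => //; apply: chain_lt_arith (le_lt le).
apply: cost_bound_weaken (b_gt (ltnW lt)); last by apply: chain_gt_arith (le_gt (ltnW lt)).
by rewrite muln_gt0 (muln_gt0 2) db0 indexg_gt0.
Qed.

(* The vectors form one orbit of size |T : S| - 1, on which T is primitive; the
   affine chain of this second action reaches T in one step. *)
Lemma cost_bound_mersenne S T S1 N k a b : affine_chain S T S1 N 2 k -> S \proper T ->
    T \subset G -> 0 < b -> maximal N T -> #|T : N| = (#|T : S|).-1 ->
  cost_bound T a b -> cost_bound S (#|T : S| ^ 4 * a) (4 * b).
Proof.
move=> ac pST sTG b0 maxN uE bT; have [_ mE k0 sS1N sNT _ j1 _ _ _ _] := ac.
have pNT := maxgroupp maxN.
have u1 : 1 < #|T : N| by rewrite indexg_gt1 proper_subn.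
have m0 : 0 < #|T : S| by rewrite indexg_gt0.
have jE : #|N : S1| = 1%N by apply/eqP; rewrite eqn_leq j1 indexg_gt0.
have [S2 [N2 [q [l ac2]]]] := affine_chain_exists (solvableS sTG solG) maxN.
have [qq qlE l0 sS2N2 sN2T comm2 j2 _ k2 _ step2] := ac2.
have uE' : (#|T : N|).+1 = #|T : S| by rewrite uE prednK.
have k1 : 1 < k.
  rewrite ltnNge; apply: contraTN u1 => k1; rewrite -leqNgt uE mE.
  by rewrite (@leq_trans (2 ^ 1).-1) // -!subn1 leq_sub2r // leq_exp2l.
(* |T : N| is both q^l and 2^k - 1, hence prime; in dimension one the second chain has N2 = T. *)
have lE : l = 1%N by apply: (@mersenne_prime_power q l k) => //; rewrite -qlE uE' mE.
have N2E := k2 lE; rewrite {N2 k2}N2E in ac2 sS2N2 sN2T comm2 j2.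
have qE : #|T : N| = q by rewrite qlE lE expn1.
have q2 : 2 < q.
  rewrite ltn_neqAle prime_gt1 // andbT; apply/eqP=> q2.
  move: uE'; rewrite qE mE -q2 => /(congr1 odd); rewrite oddX /=.
  by case: k k1 {ac mE k0}.
have jj0 : 0 < #|T : S2| by rewrite indexg_gt0.
have bS2 := cost_bound_abelian genX solG sS2N2 sTG comm2 bT b0.
have [b_lt b_gt] := cost_bound_step genX solG qq step2 pNT sS2N2 sTG bS2.
(* The orbit has size t = m - 1 > 1, so 2 t <= m is impossible. *)
have no_gt : 2 * #|T : S1| <= #|T : S| -> False.
  rewrite -(Lagrange_index sNT sS1N) jE muln1 -uE' double_gt_succ //.
have [le | lt] := leqP #|T : N| (2 * #|T : S2|).
  apply: (cost_bound_chain ac pST sTG (d := 1%N) (x := step_cost q * #|T : S2| ^ 2)) => //.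
  - by rewrite mul1n -mulnA; apply: b_lt.
  - by move=> _; rewrite jE -uE' qE; apply: mersenne_lt.
apply: (cost_bound_chain ac pST sTG (d := 2 * #|T : S2|) (x := step_cost q * #|T : S2| ^ 2 * q)) => //.
- by rewrite muln_gt0.
- by rewrite mersenne_perm1 (mulnAC 2 _ b); have := b_gt (ltnW lt); rewrite qE.
- by move=> _; rewrite jE -uE' qE; apply: mersenne_gt.
Qed.

(** Both claims go by induction on |T : S|. A subgroup strictly between S and T earns the factor 1/4
    twice; this sharper bound is what characteristic 2 requires when N is not maximal. *)
Lemma cost_bound_index S T a b :
    S \subset T -> T \subset G -> 0 < b -> S \proper T -> cost_bound T a b ->
  cost_bound S (#|T : S| ^ 4 * a) (4 * b) /\
  (~~ maximal S T -> cost_bound S (#|T : S| ^ 4 * a) (16 * b)).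
Proof.
have [n] := ubnP #|T : S|; elim: n S T a b => // n IHn S T a b ltn sST sTG b0 pST bT.
have m1 : 1 < #|T : S| by rewrite indexg_gt1 proper_subn.
have nonmax : ~~ maximal S T -> cost_bound S (#|T : S| ^ 4 * a) (16 * b).
  move=> nmaxS; have [T1 maxS sT1T] := maximal_above pST.
  have pST1 := maxgroupp maxS; have sST1 := proper_sub pST1.
  have pT1T : T1 \proper T.
    rewrite properEneq sT1T andbT; apply: contra nmaxS => /eqP eT.
    by rewrite -eT.
  have eI := Lagrange_index sT1T sST1.
  have m2 : 1 < #|T : T1| by rewrite indexg_gt1 proper_subn.
  have m3 : 1 < #|T1 : S| by rewrite indexg_gt1 proper_subn.
  have lt2 : #|T : T1| < n.
    by rewrite -ltnS; apply: leq_trans ltn; rewrite ltnS -eI ltn_Pmulr // ltnW.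
  have lt1 : #|T1 : S| < n.
    by rewrite -ltnS; apply: leq_trans ltn; rewrite ltnS -eI ltn_Pmull // ltnW.
  have [bT1 _] := IHn T1 T a b lt2 sT1T sTG b0 pT1T bT.
  have b40 : 0 < 4 * b by rewrite muln_gt0.
  have [bS _] := IHn S T1 _ _ lt1 sST1 (subset_trans sT1T sTG) b40 pST1 bT1.
  by rewrite -eI (mulnC #|T : T1|) expnMn -mulnA -(mulnA 4 4 b).
split=> //; have [maxS | nmaxS] := boolP (maximal S T); last first.
  apply: cost_bound_weaken (nonmax nmaxS); first by rewrite muln_gt0.
  by rewrite leq_mul2l leq_mul2r !orbT.
have [S1 [N [p [k ac]]]] := affine_chain_exists (solvableS sTG solG) maxS.
have [pp mE k0 sS1N sNT _ jp up k1 half _] := ac.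
have p1 := prime_gt1 pp.
have j0 : 0 < #|N : S1| by rewrite indexg_gt0.
have u0 : 0 < #|T : N| by rewrite indexg_gt0.
have m0 : 0 < #|T : S| := ltnW m1.
have pm : p <= #|T : S| by rewrite mE -[X in X <= _]expn1 leq_exp2l.
have pp0 : 0 < p.-1 by rewrite -ltnS prednK // ltnW.
have tE := Lagrange_index sNT sS1N.
have um : #|T : N| * p.-1 <= #|T : S| := leq_trans up (leq_pred _).
have ltu : #|T : N| < #|T : S|.
  by rewrite -(prednK m0) ltnS; apply: leq_trans up; rewrite leq_pmulr.
(* If N = T, as in dimension one, nothing is lost between T and N. *)
have [eN | neN] := eqVneq N T.
  apply: (cost_bound_chain ac pST sTG (d := 1%N) (x := 1%N)) => //; first by rewrite !mul1n eN.
    by move=> _; apply: one_chain_lt.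
  by move=> _; rewrite -tE eN indexgg; apply: one_chain_gt; rewrite // -eN.
have pNT : N \proper T by rewrite properEneq neN.
have ltun : #|T : N| < n by rewrite -ltnS; apply: leq_trans ltn; rewrite ltnS.
have [bN4 bN16] := IHn N T a b ltun sNT sTG b0 pNT bT.
(* For odd p, |T : N| is at most m / (p - 1), and the fourth power of p - 1 pays for [step_cost p]
   and j^2. *)
have [p2 | p2] := ltnP 2 p.
  apply: (cost_bound_chain ac pST sTG b0 _ bN4) => //.
    by move=> _; apply: odd_chain_lt.
  by move=> _; rewrite -tE; apply: odd_chain_gt.
have {p2} p2 : p = 2 by apply/eqP; rewrite eqn_leq p2.
rewrite {}p2 in ac jp half.
have jE : #|N : S1| = 1%N by apply/eqP; rewrite eqn_leq jp.
(* For p = 2, |T : N| may be as large as m - 1, and the gain of 1/16 makes up for it. *)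
have [maxN | nmaxN] := boolP (maximal N T); last first.
  apply: (cost_bound_chain ac pST sTG b0 _ (bN16 nmaxN)) => //.
    by move=> _; rewrite jE; apply/two_chain_lt/ltnW.
  by move=> _; rewrite -tE jE; apply/two_chain_gt/ltnW.
(* With N maximal, either the orbit has fewer than m / 2 vectors, or it consists of all nonzero
   vectors, which is the Mersenne case. *)
rewrite -tE jE muln1 in half; case: half => [half | uE]; last exact: cost_bound_mersenne ac _ _ _ _ _ _.
apply: (cost_bound_chain ac pST sTG b0 _ bN4) => //; rewrite -tE jE muln1.
  by rewrite leqNgt half.
by move=> _; have := two_chain_half (ltnW half); rewrite (muln1 #|T : N|).
Qed.

Lemma short_elem_index S : S \subset G -> short_elem X G S (64 * #|G : S| ^ 4).
Proof.
(* For S = G the length is 0 and the index 1, so only the constant 64 remains. *)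
move=> sSG; have bG : cost_bound G 64 1.
  by exists 0%N; [apply: short_elem_full | rewrite indexgg].
have [/eqP eS | neS] := boolP (S == G :> {set gT}).
  by apply: short_elem_mono (leq0n _) _; rewrite (_ : S = G); [apply: short_elem_full | apply: val_inj].
have pSG : S \proper G by rewrite properEneq neS.
have [[c sS le] _] := cost_bound_index sSG (subxx G) (ltn0Sn 0) pSG bG.
apply: short_elem_mono sS; apply: leq_trans (leq_addr _ c) _.
apply: leq_trans (leq_pmull _ _) (leq_trans le _) => //.
by rewrite mulnC.
Qed.

End Recursion.

Lemma gcore_stab_trans n (G : {group 'S_n}) i :
  [transitive G, on [set: 'I_n] | 'P] -> gcore 'C_G[i | 'P] G = 1.
Proof.
move=> trG; apply/trivgP/subsetP=> x Cx; apply/set1gP/permP=> j; rewrite perm1.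
have [g Gg ->] := atransP2 trG (in_setT i) (in_setT j).
have := bigcapP Cx g Gg; rewrite mem_conjg => /setIP[_ /astab1P].
by rewrite /= !apermE conjgE invgK !permM => e; rewrite -[in RHS]e permKV.
Qed.

Lemma diam_core (gT : finGroupType) (G S : {group gT}) :
    solvable G -> S \subset G -> gcore S G = 1 ->
  diam G <= 288 * #|G : S| ^ 5.
Proof.
move=> solG sSG coreS; apply: leq_trans (diam_short_elem coreS _) _.
  by move=> X genX; apply: short_elem_index genX solG _ sSG.
apply: diam_arith; first by rewrite indexg_gt0.
rewrite -(indexg1 G) -coreS.
by apply: leq_trans (sopfr_core solG sSG) _; rewrite leq_mul2l leq_subr orbT.
Qed.

Theorem theorem1p7 :
  exists C : nat, (0 < C)%N /\
    forall (n : nat) (G : {group 'S_n}),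
      (1 <= n)%N ->
      solvable G ->
      [transitive G, on [set: 'I_n] | 'P] ->
      (diam G <= C * n ^ 5)%N.
Proof.
exists 288; split=> // n G n0 solG trG; pose i : 'I_n := Ordinal n0.
have stabG : 'C_G[i | 'P] \subset G by apply: subsetIl.
have := diam_core solG stabG (gcore_stab_trans i trG).
by rewrite -card_orbit (atransP trG) ?in_setT // cardsT card_ord.
Qed.
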